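(* There exists a positive cone for $F_2\times\mathbb{Z}$ which is finitely generated as a semigroup.
   Context: $F_2$ is the free group of rank $2$. A positive cone of a group $G$ is a subset $P\subseteq G$ such that $PP\subseteq P$ and $G=P\sqcup P^{-1}\sqcup\{1\}$ (disjoint union). *)

(* Defs.v *)
From HB Require Import structures.
From mathcomp Require Import all_boot all_order all_algebra.
From mathcomp Require Import boolp classical_sets functions cardinality.

Set Implicit Arguments.
Unset Strict Implicit.
Unset Printing Implicit Defensive.

Local Open Scope group_scope.

(* The free group on T, realized as the set of reduced words.
   A letter (x, true) stands for the generator x, (x, false) for its inverse. *)

Section Words.
Variable T : choiceType.

Definition letter : Type := (T * bool)%type.
HB.instance Definition _ := Choice.on letter.

Implicit Types (a b : letter) (u v w : seq letter).

Definition letter_inv a : letter := (a.1, ~~ a.2).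

Definition reduced w : bool := sorted (fun a b => b != letter_inv a) w.

Definition push a w : seq letter :=
  if w is b :: w' then if b == letter_inv a then w' else a :: w else [:: a].

Definition reduce w : seq letter := foldr push [::] w.

Definition word_inv w : seq letter := rev (map letter_inv w).

Lemma letter_invK : involutive letter_inv.
Proof. by case=> x e; rewrite /letter_inv /= negbK. Qed.

Lemma push_reduced a w : reduced w -> reduced (push a w).
Proof.
rewrite /reduced; case: w => [//|b w] /= pw.
case: ifPn => [_|nb]; first exact: path_sorted pw.
by rewrite /= nb.
Qed.

Lemma foldr_push_reduced u w : reduced w -> reduced (foldr push w u).
Proof. by move=> rw; elim: u => //= a u IHu; apply: push_reduced. Qed.

Lemma reduce_reduced w : reduced (reduce w).
Proof. exact: foldr_push_reduced. Qed.

Lemma reduce_id w : reduced w -> reduce w = w.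
Proof.
elim: w => [//|a w IHw] rw; rewrite /reduce /= -/(reduce w) IHw; last first.
  exact: path_sorted rw.
by case: w rw {IHw} => [//|b w] /= /andP[/negbTE->].
Qed.

Lemma pushK a w : reduced w -> push (letter_inv a) (push a w) = w.
Proof.
case: w => [|b w] /=; first by rewrite letter_invK eqxx.
case: (eqVneq b (letter_inv a)) => [->|_ _] /=.
  by case: w => [//|c w] /= /andP[/negbTE->].
by rewrite letter_invK eqxx.
Qed.

Lemma pushKV a w : reduced w -> push a (push (letter_inv a) w) = w.
Proof. by move=> rw; rewrite -{1}[a]letter_invK pushK. Qed.

Lemma foldr_push_push a u w : reduced w ->
  foldr push w (push a u) = push a (foldr push w u).
Proof.
move=> rw; case: u => [//|b u] /=.
by case: eqVneq => [->|//]; rewrite pushKV // foldr_push_reduced.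
Qed.

Lemma foldr_push_reduce u w : reduced w ->
  foldr push w (reduce u) = foldr push w u.
Proof. by move=> rw; elim: u => //= a u <-; rewrite foldr_push_push. Qed.

Lemma reduce_cat u v : reduce (u ++ v) = foldr push (reduce v) u.
Proof. by rewrite /reduce foldr_cat. Qed.

Lemma reduce_catl u v : reduce (reduce u ++ v) = reduce (u ++ v).
Proof. by rewrite !reduce_cat foldr_push_reduce // reduce_reduced. Qed.

Lemma reduce_catr u v : reduce (u ++ reduce v) = reduce (u ++ v).
Proof. by rewrite !reduce_cat (reduce_id (reduce_reduced v)). Qed.

Lemma word_invK : involutive word_inv.
Proof.
by move=> w; rewrite /word_inv map_rev revK mapK //; apply: letter_invK.
Qed.

Lemma reduce_word_inv w : reduce (word_inv w ++ w) = [::].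
Proof.
elim: w => [//|a w IHw]; rewrite /word_inv map_cons rev_cons cat_rcons.
by rewrite reduce_cat /= pushK ?reduce_reduced // -reduce_cat.
Qed.

Lemma word_inv_reduced w : reduced w -> reduced (word_inv w).
Proof.
rewrite /reduced /word_inv rev_sorted sorted_map.
congr is_true; congr (sorted _ w).
apply/funext => a; apply/funext => b /=; rewrite letter_invK.
by congr negb; apply/eqP/eqP => [->|->]; rewrite ?letter_invK.
Qed.

End Words.

Section FreeGroup.
Variable T : choiceType.

Record free_group : Type := FreeGroup {
  word_of : seq (letter T);
  _ : reduced word_of
}.

HB.instance Definition _ := [isSub for word_of].
HB.instance Definition _ := [Choice of free_group by <:].

Implicit Types x y z : free_group.

Definition free_group_one : free_group := @FreeGroup [::] isT.

Definition free_group_mul x y : free_group :=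
  FreeGroup (reduce_reduced (word_of x ++ word_of y)).

Definition free_group_inv x : free_group :=
  FreeGroup (word_inv_reduced (valP x)).

Lemma free_group_mulA : associative free_group_mul.
Proof.
by move=> x y z; apply: val_inj; rewrite /= reduce_catr reduce_catl catA.
Qed.

Lemma free_group_mul1 : left_id free_group_one free_group_mul.
Proof. by move=> x; apply: val_inj; rewrite /= reduce_id ?(valP x). Qed.

Lemma free_group_mulr1 : right_id free_group_one free_group_mul.
Proof. by move=> x; apply: val_inj; rewrite /= cats0 reduce_id ?(valP x). Qed.

Lemma free_group_mulV : left_inverse free_group_one free_group_inv free_group_mul.
Proof. by move=> x; apply: val_inj; rewrite /= reduce_word_inv. Qed.

Lemma free_group_mulrV :
  right_inverse free_group_one free_group_inv free_group_mul.
Proof.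
move=> x; apply: val_inj => /=.
by rewrite -{1}[word_of x]word_invK reduce_word_inv.
Qed.

HB.instance Definition _ := isGroup.Build free_group
  free_group_mulA free_group_mul1 free_group_mulr1
  free_group_mulV free_group_mulrV.

Definition free_gen (t : T) : free_group := @FreeGroup [:: (t, true)] isT.

End FreeGroup.

Section Universal.
Variables (T : choiceType) (H : groupType) (f : T -> H).

Definition letter_eval (a : letter T) : H :=
  if a.2 then f a.1 else (f a.1)^-1.

Definition word_eval (w : seq (letter T)) : H :=
  foldr (fun a h => letter_eval a * h) 1 w.

Lemma letter_eval_inv a : letter_eval (letter_inv a) = (letter_eval a)^-1.
Proof. by case: a => t [] //=; rewrite /letter_eval /= invgK. Qed.

Lemma word_eval_push a w : word_eval (push a w) = letter_eval a * word_eval w.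
Proof.
case: w => [//|b w] /=; case: eqVneq => [->|//].
by rewrite letter_eval_inv mulgA mulgV mul1g.
Qed.

Lemma word_eval_reduce w : word_eval (reduce w) = word_eval w.
Proof. by elim: w => //= a w IHw; rewrite word_eval_push IHw. Qed.

Lemma word_eval_cat u v : word_eval (u ++ v) = word_eval u * word_eval v.
Proof. by elim: u => [|a u IHu] /=; rewrite ?mul1g // IHu mulgA. Qed.

Lemma free_group_universal :
  exists! phi : free_group T -> H,
    {morph phi : x y / x * y} /\ forall t, phi (free_gen t) = f t.
Proof.
exists (fun x => word_eval (word_of x)); split.
  split=> [x y|t]; first by rewrite /= word_eval_reduce word_eval_cat.
  by rewrite /= mulg1.
move=> phi [phiM phig]; apply/funext => -[w rw] /=.
have phi1 : phi 1 = 1.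
  by apply: (mulgI (phi 1)); rewrite -phiM !mulg1.
have phiV x : phi x^-1 = (phi x)^-1.
  by apply: (mulgI (phi x)); rewrite -phiM !mulgV.
elim: w rw => [|a w IHw] rw /=.
  by rewrite -phi1; congr phi; apply: val_inj.
have rw' : reduced w by exact: path_sorted rw.
have -> : FreeGroup rw =
    (if a.2 then free_gen a.1 else (free_gen a.1)^-1) * FreeGroup rw'.
  apply: val_inj; rewrite -[LHS](reduce_id rw) /=.
  rewrite -(reduce_id rw').
  by case: a rw => t [] rw /=; rewrite -/(reduce _) (reduce_id (reduce_reduced w)).
rewrite phiM -IHw /letter_eval.
by case: (a.2); rewrite ?phiV phig.
Qed.

End Universal.

Definition F2 : groupType := free_group 'I_2.

(* [Algebra.to_multiplicative int] is int with addition as its group law. *)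
Definition Zgrp : groupType := Algebra.to_multiplicative int.

Definition F2xZ : groupType := (F2 * Zgrp)%type.

Local Open Scope classical_set_scope.

Section PositiveCone.
Variable G : groupType.
Implicit Types P S : set G.

Definition mul_closed P : Prop := [set x * y | x in P & y in P] `<=` P.

Definition inv_set P : set G := [set x^-1 | x in P].

Definition positive_cone P : Prop :=
  [/\ mul_closed P,
      [set: G] = P `|` inv_set P `|` [set 1],
      P `&` inv_set P = set0,
      P `&` [set 1] = set0 &
      inv_set P `&` [set 1] = set0].

Definition generated_semigroup S : set G := smallest mul_closed S.

Definition fg_semigroup P : Prop :=
  exists S, finite_set S /\ P = generated_semigroup S.

End PositiveCone.

(* Main.v *)
Require Import Defs.
From mathcomp Require Import all_boot all_algebra classical_sets.
From mathcomp Require Import order cardinality.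
From mathcomp Require Import zify ring lra.

(** The group F_2 x Z sits with finite index in the braid group B_3, which has a
    finitely generated positive cone, and the trace of that cone turns out to
    be finitely generated too.  In detail, B_3 is generated by c and d subject
    to d c^2 d = c, the element c^3 is central, and the semigroup generated by c
    and d is a positive cone (Dubrovina and Dubrovin).  The kernel of the
    morphism from B_3 to Z/6 with c |-> 2 and d |-> -1 is F_2 x Z: the central
    factor is spanned by z = c^3, and the free factor by the elements
    t_i = d^i c d^(2-i), which satisfy t_(i+1) t_(i-1) = t_i and are therefore
    all words in x = t_0 and y = t_1.  With delta = d^6, the elements
    d^a c d^b of the kernel are exactly the t_a delta^m, where
    b = 2 - a + 6 m.  The cone constructed below is the trace on the kernel of
    the cone of B_3: the products of at least one t_i and powers of delta,
    together with the positive powers of delta.  The proof does not construct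
    the braid group: it only uses the recurrence of the t_i, the centrality of
    z and the definition z delta = t_0 t_(-3), from which t_i t_(i-3) = z delta
    for all i and delta t_i = t_(i+6) delta.

    Finite generation ([cone_t]).  The relation t_a = t_(a+1) t_(a-1), with a
    power of delta inserted between the factors, reads
    d^a c d^b = (d^(a+1) c d^e) (d^(-e) c d^(b+1)) for every e of the right
    class modulo 6.  Choosing e with both e and -e at least -3 gives all
    t_a delta^m from those with a, b >= -3, and these arise from six of them
    by multiplication by delta on either side.

    Totality ([cone_total]).  Since t_i^-1 = z^-1 delta^-1 t_(i+3), each element
    is z^-k times a product q of t_i and powers of delta.  A factor
    t_a t_b with b < a - 1 either merges into one letter (b = a - 2) or
    releases a factor z (b <= a - 3).  So either q is divisible by z, and k can
    be lowered, or q can be written with b >= a - 1 for all consecutive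
    letters; for such a q the element z q^-1 is again a product of t_i and
    powers of delta, so the inverse of z^-k q is one too when k >= 1.

    The identity is not in the cone ([cone_moves_up]).  Lifting the action of
    the modular group on the cusps, i.e. the rational points of the
    projective line, c and d act on Z copies of the cusps.  The map d fixes
    the cusp at infinity of level 0, both d and d^-1 preserve the part above
    it, and c maps this cusp and the part above it to the part above it.
    Hence a product of the chosen generators either moves this cusp up, or is
    a positive power of delta, which is nontrivial by its Z-coordinate. *)

Set Implicit Arguments.
Unset Strict Implicit.
Unset Printing Implicit Defensive.

Import Order.TTheory GRing.Theory Num.Theory.
Local Open Scope group_scope.

(** * Iteration indexed by the integers *)

Lemma int_succ_ind (Q : int -> Prop) :
  Q 0%R ->
  (forall i, Q i -> Q (i + 1)%R) ->
  (forall i : int, Q (i + 1)%R -> Q i) ->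
  forall i, Q i.
Proof.
move=> Q0 QS QP; elim/int_rect => [//|n Qn|n Qn].
  have -> : (n.+1%:Z = n%:Z + 1)%R by lia.
  exact: QS.
apply: QP; have -> : (- n.+1%:Z + 1 = - n%:Z)%R by lia.
by [].
Qed.

(** The [i]-th power of [f], where [g] stands for the inverse of [f]. *)
Definition iterz (A : Type) (f g : A -> A) (i : int) (a : A) : A :=
  match i with Posz n => iter n f a | Negz n => iter n.+1 g a end.

Lemma iterz_succ (A : Type) (f g : A -> A) i a :
  cancel g f -> iterz f g (i + 1)%R a = f (iterz f g i a).
Proof.
move=> gK; case: i => [n|[|n]].
- by have -> : (n%:Z + 1 = n.+1%:Z)%R by lia.
- by rewrite /= gK.
- have -> : (Negz n.+1 + 1 = Negz n)%R by lia.
  by rewrite /= gK.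
Qed.

(** * The cone of a recurrent family of group elements *)

Lemma semigroupM (G : groupType) (S : set G) g h :
  generated_semigroup S g -> generated_semigroup S h ->
  generated_semigroup S (g * h).
Proof.
move=> gP hP U US; apply: US.1.
by exists g; [exact: (gP U US) | exists h; [exact: (hP U US) | by []]].
Qed.

Section Cone.
Variables (G : groupType) (t : int -> G) (z delta : G).
Hypothesis t_rec : forall i : int, t (i + 1)%R * t (i - 1)%R = t i.
Hypothesis z_central : forall g, z * g = g * z.
Hypothesis delta_def : t 0%R * t (- 3)%R = z * delta.

Definition dpow (m : int) : G := iterz ( *%g delta) ( *%g delta^-1) m 1.

Lemma t_gap2 (i j : int) : (j = i - 2)%R -> t i * t j = t (i - 1)%R.
Proof.
move=> ->; rewrite -[RHS]t_rec.
by congr (t _ * t _); lia.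
Qed.

(** The product does not depend on [i]: splitting [t i] as
    [t (i + 1) * t (i - 1)] and merging [t (i - 1) * t (i - 3)] shifts it by
    one. *)
Lemma t_gap3 (i j : int) : (j = i - 3)%R -> t i * t j = z * delta.
Proof.
move=> ->; rewrite -delta_def.
have step k : t (k + 1)%R * t (k + 1 - 3)%R = t k * t (k - 3)%R.
  rewrite -[in RHS](t_rec k) -mulgA (@t_gap2 (k - 1)%R); last by lia.
  by congr (t _ * t _); lia.
elim/int_succ_ind: i => [|i IH|i]; first by congr (t _ * t _).
  by rewrite step.
by rewrite step.
Qed.

(** Both sides, multiplied by [z], equal [t (i + 6) * t (i + 3) * t i]. *)
Lemma deltaC i : delta * t i = t (i + 6)%R * delta.
Proof.
apply: (mulgI z); rewrite mulgA -(@t_gap3 (i + 6) (i + 3))%R; last by lia.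
rewrite -mulgA (@t_gap3 (i + 3)%R i); last by lia.
by rewrite !mulgA z_central.
Qed.

Lemma dpow0 : dpow 0%R = 1. Proof. by []. Qed.

Lemma dpow_succ m : dpow (m + 1)%R = delta * dpow m.
Proof. by apply: iterz_succ => g; rewrite mulVKg. Qed.

Lemma dpow1 : dpow 1%R = delta. Proof. exact: mulg1. Qed.

Lemma dpowD m n : dpow (m + n)%R = dpow m * dpow n.
Proof.
elim/int_succ_ind: m => [|m IH|m IH]; first by rewrite add0r mul1g.
  by rewrite addrAC !dpow_succ IH mulgA.
by apply: (mulgI delta); rewrite mulgA -!dpow_succ -IH addrAC.
Qed.

Lemma dpowV m : dpow (- m)%R = (dpow m)^-1.
Proof. by apply/esym/mulg1_eq; rewrite -dpowD subrr. Qed.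

Lemma dpowC m i : dpow m * t i = t (i + 6 * m)%R * dpow m.
Proof.
elim/int_succ_ind: m i => [|m IH|m IH] i.
- by rewrite mulr0 addr0 dpow0 mul1g mulg1.
- rewrite !dpow_succ -mulgA IH !mulgA deltaC.
  by congr (t _ * _ * _); lia.
- apply: (mulgI delta); rewrite mulgA -dpow_succ IH dpow_succ !mulgA deltaC.
  by congr (t _ * _ * _); lia.
Qed.

Lemma dpow_prod m w :
  dpow m * \prod_(i <- w) t i = \prod_(i <- map (+%R (6 * m)%R) w) t i * dpow m.
Proof.
elim: w => [|i w IH]; first by rewrite /= !big_nil mul1g mulg1.
by rewrite /= !big_cons mulgA dpowC -mulgA IH mulgA addrC.
Qed.

(** Rewrites the generators with negative index in terms of [t 0], [t 1] and
    [t 2], which makes their action on the cusps explicit. *)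
Lemma t_dpowN1 (i j : int) : (j = i - 3)%R -> t j * dpow (-1)%R = (t i)^-1 * z.
Proof.
move=> Ej; apply: (mulgI (t i)); rewrite mulgA (t_gap3 Ej) mulVKg.
by rewrite dpowV dpow1 mulgK.
Qed.

(** Powers of [delta] can be collected on the right by [dpow_prod], so these are
    all the products of [t i] and powers of [delta]. *)
Definition tmonoid (g : G) : Prop :=
  exists (w : seq int) (m : int), g = \prod_(i <- w) t i * dpow m.

Lemma tmonoid_dpow m : tmonoid (dpow m).
Proof. by exists [::], m; rewrite big_nil mul1g. Qed.

Lemma tmonoid1 : tmonoid 1. Proof. exact: (tmonoid_dpow 0). Qed.

Lemma tmonoid_prod w : tmonoid (\prod_(i <- w) t i).
Proof. by exists w, 0%R; rewrite mulg1. Qed.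

Lemma tmonoid_t i : tmonoid (t i).
Proof. by have := tmonoid_prod [:: i]; rewrite big_seq1. Qed.

Lemma tmonoidM g h : tmonoid g -> tmonoid h -> tmonoid (g * h).
Proof.
move=> [w [m ->]] [v [n ->]].
exists (w ++ map (+%R (6 * m)%R) v), (m + n)%R.
by rewrite big_cat dpowD !mulgA -(mulgA (\prod_(i <- w) t i)) dpow_prod !mulgA.
Qed.

Lemma z_eq : z = t 0%R * t (- 3)%R * dpow (- 1)%R.
Proof. by rewrite (@t_gap3 0%R) // dpowV dpow1 mulgK. Qed.

Lemma tmonoid_zX k : tmonoid (z ^+ k).
Proof.
elim: k => [|k IH]; first exact: tmonoid1.
rewrite expgS; apply: tmonoidM => //; rewrite z_eq.
apply: (tmonoidM _ (tmonoid_dpow _)).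
exact: tmonoidM (tmonoid_t _) (tmonoid_t _).
Qed.

Lemma z_tV i : z * (t i)^-1 = delta^-1 * t (i + 3)%R.
Proof.
have E : t (i + 3)%R * t i = z * delta by apply: t_gap3; lia.
by apply: (mulIg (t i)); rewrite mulgVK -mulgA E z_central mulKg.
Qed.

Lemma tV i : (t i)^-1 = z^-1 * (delta^-1 * t (i + 3)%R).
Proof. by rewrite -z_tV mulKg. Qed.

(** Iterating [t j = t (j + 1) * t (j - 1)] on the last letter descends from [j]
    to [i]. *)
Lemma t_split (i j : int) : (i < j)%R ->
  exists2 q, tmonoid q & t j = q * t (i + 2)%R * t i.
Proof.
move=> lt_ij; have [n ->] : exists n : nat, (j = i + 1 + n%:Z)%R.
  by exists (absz (j - i - 1)%R); lia.
elim: n {lt_ij j} => [|n [q qM IH]].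
  exists 1; first exact: tmonoid1.
  by rewrite mul1g t_gap2; [congr t|]; lia.
exists (t (i + 1 + n.+2%:Z)%R * q); first exact: tmonoidM (tmonoid_t _) qM.
by rewrite -!mulgA (mulgA q) -IH t_gap2; [congr t|]; lia.
Qed.

(** The pairs for which [t a * t b] neither merges into one letter nor releases
    a factor [z]. *)
Definition tight (a b : int) : bool := (a - 1 <= b)%R.

(** If [b = a - 2] then [t a * t b] is one letter, and the word gets shorter.
    If [b <= a - 3] then [t a] can be written so as to end in [t (b + 3)], and
    [t (b + 3) * t b = z * delta]. *)
Lemma tight_insert v a : sorted tight v ->
  (exists2 q, tmonoid q & t a * \prod_(i <- v) t i = z * q) \/
  (exists2 w, sorted tight w & t a * \prod_(i <- v) t i = \prod_(i <- w) t i).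
Proof.
elim: v a => [|b v IH] a sv.
  by right; exists [:: a] => //; rewrite big_nil big_seq1 mulg1.
have [ab|ab] := boolP (a - 1 <= b)%R.
  by right; exists (a :: b :: v); rewrite ?big_cons //= {1}/tight ab.
have sv' := path_sorted sv; rewrite big_cons mulgA.
have [->|b_neq] := eqVneq b (a - 2)%R.
  by rewrite t_gap2 //; apply: IH.
left; have [->|b_neq'] := eqVneq b (a - 3)%R.
  exists (delta * \prod_(i <- v) t i); last by rewrite t_gap3 // mulgA.
  by apply: tmonoidM (tmonoid_prod _); rewrite -dpow1; apply: tmonoid_dpow.
have [|q qM ->] := @t_split (b + 3) a; first by lia.
exists (q * t (b + 3 + 2)%R * (delta * \prod_(i <- v) t i)).
  apply: tmonoidM; first exact: tmonoidM qM (tmonoid_t _).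
  by apply: tmonoidM (tmonoid_prod _); rewrite -dpow1; apply: tmonoid_dpow.
rewrite -(mulgA _ (t _) (t b)) t_gap3; last by lia.
by rewrite -!mulgA z_central -!mulgA z_central !mulgA.
Qed.

Lemma tight_normal w :
  (exists2 q, tmonoid q & \prod_(i <- w) t i = z * q) \/
  (exists2 v, sorted tight v & \prod_(i <- w) t i = \prod_(i <- v) t i).
Proof.
elim: w => [|a w [[q qM Ew]|[v sv Ew]]]; rewrite ?big_cons ?Ew.
- by right; exists [::].
- left; exists (t a * q); first exact: tmonoidM (tmonoid_t _) qM.
  by rewrite !mulgA z_central.
- exact: tight_insert.
Qed.

(** A single inverse costs one factor [z], as
    [z * (t i)^-1 = delta^-1 * t (i + 3)].
    Tightness makes this one factor enough for the whole word: the final letter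
    [t (b + 2)] obtained for the tail starting with [b] has an index larger than
    the preceding letter [a], so by [t_split] it absorbs [(t a)^-1], leaving
    the final letter [t (a + 2)]. *)
Lemma tight_inv a v : sorted tight (a :: v) ->
  exists2 q, tmonoid q & z * (\prod_(i <- a :: v) t i)^-1 = q * t (a + 2)%R.
Proof.
elim: v a => [|b v IH] a.
  move=> _; exists (delta^-1 * t (a + 4)%R).
    apply: tmonoidM (tmonoid_t _).
    by rewrite -dpow1 -dpowV; apply: tmonoid_dpow.
  rewrite big_seq1 z_tV -mulgA t_gap2; last by lia.
  by congr (_ * t _); lia.
move=> /= /andP[]; rewrite {1}/tight => ab /IH[q qM IHv].
have [|q' q'M Eb] := @t_split a (b + 2)%R; first by lia.
exists (q * q'); first exact: tmonoidM.
by rewrite big_cons invgM mulgA IHv Eb !mulgA mulgK.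
Qed.

Lemma tmonoid_total k q : tmonoid q ->
  tmonoid (z ^- k * q) \/ tmonoid (z ^- k * q)^-1.
Proof.
elim: k q => [|k IH] q qM; first by left; rewrite invg1 mul1g.
have [w [m Eq]] := qM.
have [[q' q'M Ew]|[v sv Ew]] := tight_normal w.
  have -> : z ^- k.+1 * q = z ^- k * (q' * dpow m).
    by rewrite Eq Ew expgS invgM -!mulgA mulKg.
  by apply: IH; apply: tmonoidM (tmonoid_dpow _).
right; rewrite Eq Ew invgM invgK invgM -dpowV -mulgA expgS.
apply: (tmonoidM (tmonoid_dpow _)); rewrite mulgA -z_central.
apply: tmonoidM (tmonoid_zX _).
case: v sv {Ew} => [|a v] sv.
  by rewrite big_nil invg1 mulg1 -[z]expg1; apply: tmonoid_zX.
by have [q' q'M ->] := tight_inv sv; apply: tmonoidM (tmonoid_t _).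
Qed.

Definition tfrac (g : G) : Prop :=
  exists k q, tmonoid q /\ g = z ^- k * q.

Lemma tfrac1 : tfrac 1.
Proof. by exists 0%N, 1; split; [exact: tmonoid1 | rewrite invg1 mul1g]. Qed.

Lemma tfrac_tmonoid q g : tmonoid q -> tfrac g -> tfrac (q * g).
Proof.
move=> qM [k [r [rM ->]]]; exists k, (q * r); split; first exact: tmonoidM.
rewrite !mulgA; congr (_ * r).
by apply: commuteV; apply: commuteX; apply/esym/z_central.
Qed.

Lemma tfrac_zV g : tfrac g -> tfrac (z^-1 * g).
Proof.
by move=> [k [r [rM ->]]]; exists k.+1, r; rewrite expgSr invgM -mulgA.
Qed.

Lemma tfrac_tV i g : tfrac g -> tfrac ((t i)^-1 * g).
Proof.
move=> gT; rewrite tV -mulgA; apply/tfrac_zV/(tfrac_tmonoid _ gT).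
by rewrite -dpow1 -dpowV; apply: tmonoidM (tmonoid_dpow _) (tmonoid_t _).
Qed.

(** In the braid group these are [d^6] and the six elements [d^a c d^b] with
    [-3 <= a, b <= 2] and [a + b] congruent to 2 modulo 6. *)
Definition cone_gens : seq G :=
  [:: delta; t (-3)%R * dpow (-1)%R; t (-2)%R * dpow (-1)%R;
      t (-1)%R * dpow (-1)%R; t 0%R; t 1%R; t 2%R].

Definition cone : set G := generated_semigroup [set` cone_gens]%classic.

Lemma cone_gensP g : g \in cone_gens -> cone g.
Proof. by move=> gS U [_]; apply. Qed.

Lemma coneM g h : cone g -> cone h -> cone (g * h).
Proof. exact: semigroupM. Qed.

Lemma cone_delta : cone delta.
Proof. by apply: cone_gensP; rewrite inE eqxx. Qed.

Lemma cone_dpow n : cone (dpow n.+1).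
Proof.
elim: n => [|n IH]; first by rewrite dpow1; apply: cone_delta.
have -> : (n.+2%:Z = n.+1%:Z + 1)%R by lia.
by rewrite dpow_succ; apply: coneM IH; apply: cone_delta.
Qed.

Lemma cone_dpowl (p : nat) g : cone g -> cone (dpow p * g).
Proof.
case: p => [|p] gP; first by rewrite dpow0 mul1g.
by apply: coneM gP; apply: cone_dpow.
Qed.

Lemma cone_dpowr (p : nat) g : cone g -> cone (g * dpow p).
Proof.
case: p => [|p] gP; first by rewrite dpow0 mulg1.
by apply: coneM gP _; apply: cone_dpow.
Qed.

(** The second hypothesis bounds the exponent [b = 2 - a + 6 * m] of
    [d^a c d^b].  Left and right multiplication by [delta] raise [a] and [b]
    by 6, so the six generators reach all exponents that are at least -3. *)
Lemma cone_t_base (a m : int) :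
  (-3 <= a)%R -> (-3 <= 2 - a + 6 * m)%R -> cone (t a * dpow m).
Proof.
move=> a_ge b_ge.
have [p [r [Ea r_ge r_le]]] :
    exists (p : nat) (r : int), [/\ a = r + 6 * p%:Z, -3 <= r & r <= 2]%R.
  exists (absz ((a + 3)%R %/ 6)%Z), (((a + 3)%R %% 6)%Z - 3)%R; split; lia.
have base : cone (t r * dpow (if (r < 0)%R then -1 else 0)%R).
  have [Er|[Er|[Er|[Er|[Er|Er]]]]] :
      (r = -3 \/ r = -2 \/ r = -1 \/ r = 0 \/ r = 1 \/ r = 2)%R by lia.
  1-6: rewrite Er; apply: cone_gensP.
  1-6: by rewrite !inE /= ?[_ * dpow 0%R]mulg1 eqxx ?orbT.
set m0 := (if _ then _ else _) in base.
have [q Em] : exists q : nat, (m = p%:Z + m0 + q%:Z)%R.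
  by exists (absz (m - m0 - p%:Z)%R); rewrite /m0; case: ifP => r0; lia.
have -> : t a * dpow m = dpow p * (t r * dpow m0) * dpow q.
  by rewrite Ea Em !dpowD !mulgA dpowC.
by apply: cone_dpowr; apply: cone_dpowl.
Qed.

(** Both exponents of [d^a c d^b] can be lowered by one, since
    [d^a c d^b = (d^(a+1) c d^e) (d^(-e) c d^(b+1))]. *)
Lemma cone_t (a m : int) : cone (t a * dpow m).
Proof.
suff main (k : nat) (b n : int) :
    (-3 - k%:Z <= b)%R -> (-3 - k%:Z <= 2 - b + 6 * n)%R ->
    cone (t b * dpow n).
  by apply: (main (absz a + absz (2 - a + 6 * m)%R)%N); lia.
elim: k b n => [|k IH] b n b_ge c_ge.
  by apply: cone_t_base; lia.
(* Here b is the exponent of d before c.  This choice of n1 makes the inserted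
   exponent e = 1 - b + 6 * n1 lie between -2 and 3, so that e and -e are both
   at least -3. *)
pose n1 := ((b + 2)%R %/ 6)%Z.
have Eb : (b = 6 * n1 + ((b + 2)%R %% 6)%Z - 2)%R by rewrite /n1; lia.
have r_ge : (0 <= ((b + 2)%R %% 6)%Z)%R by lia.
have r_le : (((b + 2)%R %% 6)%Z < 6)%R by lia.
have -> : t b * dpow n =
    (t (b + 1)%R * dpow n1) * (t (b - 1 - 6 * n1)%R * dpow (n - n1)%R).
  rewrite -mulgA (mulgA (dpow n1)) dpowC -mulgA -dpowD mulgA.
  rewrite t_gap2; last by lia.
  by congr (t _ * dpow _); lia.
by apply: coneM; apply: IH; lia.
Qed.

Lemma cone_tmonoid q : tmonoid q -> cone q \/ exists m, q = dpow m.
Proof.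
move=> [w [m ->]]; case: w => [|a w].
  by right; exists m; rewrite big_nil mul1g.
left; elim: w a => [|b w IH] a; first by rewrite big_seq1; apply: cone_t.
rewrite big_cons -mulgA; apply: coneM (IH b).
by rewrite -[t a]mulg1; apply: (cone_t a 0).
Qed.

Lemma cone_total g : tfrac g -> [\/ cone g, cone g^-1 | g = 1].
Proof.
have dpowP m : [\/ cone (dpow m), cone (dpow m)^-1 | dpow m = 1].
  case: m => [[|m]|m]; first by constructor 3.
    by constructor 1; apply: cone_dpow.
  by constructor 2; rewrite -dpowV NegzE opprK; apply: cone_dpow.
move=> [k [q [qM ->]]]; have [] := tmonoid_total k qM => /cone_tmonoid[].
- by constructor 1.
- by move=> [m ->]; apply: dpowP.
- by constructor 2.
- move=> [m Em]; have -> : z ^- k * q = dpow (- m)%R by rewrite dpowV -Em invgK.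
  exact: dpowP.
Qed.

Lemma cone_positive :
  (forall g, tfrac g) -> ~ cone 1 -> positive_cone cone.
Proof.
move=> genG not1.
have notV g : cone g -> ~ cone g^-1.
  by move=> gP gVP; apply: not1; rewrite -(mulgV g); apply: coneM.
split.
- by move=> _ [g gP [h hP <-]]; apply: coneM.
- apply/seteqP; split=> // g _.
  have [gP|gP|->] := cone_total (genG g); first by left; left.
    by left; right; exists g^-1; rewrite ?invgK.
  by right.
- apply/seteqP; split=> // g [gP [h hP Eg]].
  by case: (notV h hP); rewrite Eg.
- by apply/seteqP; split=> // g [gP /= Eg]; apply: not1; rewrite -Eg.
- apply/seteqP; split=> // g [[h hP <-] /= Eh]; apply: not1.
  by rewrite -invg1 -Eh invgK.
Qed.

End Cone.

(** * The action on lifted cusps *)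

(** The pair [(k, r)] is the cusp [r] on level [k], with [None] the cusp at
    infinity; on each level infinity comes before all rationals. *)
Definition cusp : Type := (int * option rat)%type.

Definition shift (n : int) (p : cusp) : cusp := ((p.1 + n)%R, p.2).
Definition actD (p : cusp) : cusp := (p.1, omap (fun r => r - 1)%R p.2).
Definition actDV (p : cusp) : cusp := (p.1, omap (fun r => r + 1)%R p.2).

(** The lift of [r |-> 1 / (1 - r)], which permutes infinity, 0 and 1
    cyclically; the level rises when the image passes infinity. *)
Definition actC (p : cusp) : cusp :=
  match p with
  | (k, None) => (k, Some 0%R)
  | (k, Some r) =>
    if (r < 1)%R then (k, Some (1 - r)^-1%R)
    else if r == 1%R then ((k + 1)%R, None)
    else ((k + 1)%R, Some (1 - r)^-1%R)
  end.
Definition actCV (p : cusp) : cusp := shift (-1) (actC (actC p)).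

Lemma shift0 p : shift 0 p = p.
Proof. by case: p => k r; rewrite /shift addr0. Qed.

Lemma shiftD m n p : shift m (shift n p) = shift (n + m)%R p.
Proof. by rewrite /shift /= addrA. Qed.

Lemma actDK : cancel actD actDV.
Proof. by case=> k [r|]; rewrite /actD /actDV //= subrK. Qed.

Lemma actDVK : cancel actDV actD.
Proof. by case=> k [r|]; rewrite /actD /actDV //= addrK. Qed.

Lemma actC_lt k (r : rat) :
  (r < 1)%R -> actC (k, Some r) = (k, Some (1 - r)^-1%R).
Proof. by move=> r_lt; rewrite /actC r_lt. Qed.

Lemma actC_gt k (r : rat) :
  (1 < r)%R -> actC (k, Some r) = ((k + 1)%R, Some (1 - r)^-1%R).
Proof. by move=> r_gt; rewrite /actC ltNge ltW //= gt_eqF. Qed.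

Lemma actCC_lt0 k (r : rat) :
  (r < 0)%R -> actC (actC (k, Some r)) = (k, Some (1 - r^-1)%R).
Proof.
move=> r_lt; rewrite actC_lt; last by lra.
rewrite actC_lt; last by rewrite invf_lt1; lra.
by congr (_, Some _); field; apply/andP; split; lra.
Qed.

Lemma actCC_gt0 k (r : rat) :
  (0 < r)%R -> actC (actC (k, Some r)) = ((k + 1)%R, Some (1 - r^-1)%R).
Proof.
move=> r_gt; have [r_lt|r_gt1|->] := ltgtP r 1%R.
- rewrite actC_lt // actC_gt; last by rewrite invf_gt1; lra.
  by congr (_, Some _); field; apply/andP; split; lra.
- have V_lt0 : ((1 - r)^-1 < 0)%R by rewrite invr_lt0; lra.
  rewrite actC_gt // actC_lt; last by lra.
  by congr (_, Some _); field; apply/andP; split; lra.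
- by rewrite /actC /= invr1 subrr.
Qed.

Lemma actCC_0 k : actC (actC (k, Some 0%R)) = ((k + 1)%R, None).
Proof. by rewrite (@actC_lt k 0%R) // subr0 invr1 /actC ltxx eqxx. Qed.

Lemma actC_shift n p : actC (shift n p) = shift n (actC p).
Proof.
case: p => k [r|] //=; rewrite /shift /=.
case: ifP => _ //=; case: ifP => _ /=; by rewrite addrAC.
Qed.

Lemma actC3 p : actC (actC (actC p)) = shift 1 p.
Proof.
case: p => k [r|]; last exact: actCC_0.
have [r_lt|r_gt|->] := ltgtP r 0%R; last by rewrite actCC_0.
- have V_lt0 : (r^-1 < 0)%R by rewrite invr_lt0.
  rewrite actCC_lt0 // actC_gt; last by lra.
  by congr (_, Some _); field; lra.
- have V_gt0 : (0 < r^-1)%R by rewrite invr_gt0.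
  rewrite actCC_gt0 // actC_lt; last by lra.
  by congr (_, Some _); field; lra.
Qed.

Lemma actCK : cancel actC actCV.
Proof. by move=> p; rewrite /actCV actC3 shiftD subrr shift0. Qed.

Lemma actCVK : cancel actCV actC.
Proof. by move=> p; rewrite /actCV actC_shift actC3 shiftD addrN shift0. Qed.

(** The defining relation of the braid group: with [actC3] it lets the
    action of [t 2] and [delta] take a form free of inverses of [actC]. *)
Lemma actDCCD p : actD (actC (actC (actD p))) = actC p.
Proof.
case: p => k [r|]; last by rewrite /actD /=.
have -> : actD (k, Some r) = (k, Some (r - 1)%R) by [].
have [r_lt|r_gt|->] := ltgtP r 1%R; last first.
- by rewrite subrr actCC_0.
- rewrite actCC_gt0 ?subr_gt0 // actC_gt // /actD /=.
  by congr (_, Some _); field; apply/andP; split; lra.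
- rewrite actCC_lt0 ?subr_lt0 // actC_lt // /actD /=.
  by congr (_, Some _); field; apply/andP; split; lra.
Qed.

Lemma actCDV p : actC (actDV p) = actD (actC (actC p)).
Proof. by rewrite -actDCCD actDVK. Qed.

Arguments actC : simpl never.
Arguments actD : simpl never.
Arguments actDV : simpl never.
Arguments actCV : simpl never.

(** In the braid group, [x = t_0 = c d^2] and [y = t_1 = d c d]. *)
Definition act_letter (a : letter 'I_2) (p : cusp) : cusp :=
  match a.1 == ord0, a.2 with
  | true, true => actC (actD (actD p))
  | true, false => actDV (actDV (actCV p))
  | false, true => actD (actC (actD p))
  | false, false => actDV (actCV (actDV p))
  end.

Definition act_word (w : seq (letter 'I_2)) (p : cusp) : cusp :=
  foldr act_letter p w.

Definition act (g : F2xZ) (p : cusp) : cusp :=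
  shift (g.2 : int) (act_word (word_of g.1) p).

Lemma act_letterK a : cancel (act_letter (letter_inv a)) (act_letter a).
Proof.
by case: a => i [] p; rewrite /act_letter /=; case: (i == _) => /=;
  rewrite !(actCK, actDK, actDVK, actCVK).
Qed.

Lemma act_letter_shift a n p :
  act_letter a (shift n p) = shift n (act_letter a p).
Proof.
have D_shift q : actD (shift n q) = shift n (actD q) by [].
have DV_shift q : actDV (shift n q) = shift n (actDV q) by [].
have CV_shift q : actCV (shift n q) = shift n (actCV q).
  by rewrite /actCV !actC_shift !shiftD addrC.
by case: a => i []; rewrite /act_letter /=; case: (i == _) => /=;
  rewrite !(D_shift, DV_shift, CV_shift, actC_shift).
Qed.

Lemma act_word_push a w p : act_word (push a w) p = act_letter a (act_word w p).
Proof.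
by case: w => [//|b w] /=; case: eqVneq => [->|//] /=; rewrite act_letterK.
Qed.

Lemma act_word_reduce w p : act_word (reduce w) p = act_word w p.
Proof. by elim: w => //= a w IH; rewrite act_word_push IH. Qed.

Lemma act_word_shift w n p : act_word w (shift n p) = shift n (act_word w p).
Proof. by elim: w => //= a w ->; rewrite act_letter_shift. Qed.

Lemma actM g h p : act (g * h) p = act g (act h p).
Proof.
by rewrite /act act_word_reduce /act_word foldr_cat -!/(act_word _ _)
  act_word_shift shiftD addrC.
Qed.

(** * The cone of the direct product *)

Definition gen_x : F2xZ := (free_gen (ord0 : 'I_2), 1).
Definition gen_y : F2xZ := (free_gen (ord_max : 'I_2), 1).
Definition gen_z : F2xZ := (1, (1%R : int)).

Lemma act1 p : act 1 p = p. Proof. exact: shift0. Qed.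

Lemma act_x p : act gen_x p = actC (actD (actD p)).
Proof. exact: shift0. Qed.

Lemma act_y p : act gen_y p = actD (actC (actD p)).
Proof. exact: shift0. Qed.

Lemma act_z p : act gen_z p = shift 1 p.
Proof. by []. Qed.

Lemma act_xV p : act gen_x^-1 p = actDV (actDV (actCV p)).
Proof. exact: shift0. Qed.

Lemma act_yV p : act gen_y^-1 p = actDV (actCV (actDV p)).
Proof. exact: shift0. Qed.

Lemma act_zV p : act gen_z^-1 p = shift (-1) p.
Proof. by []. Qed.

Lemma gen_z_central g : gen_z * g = g * gen_z.
Proof.
case: g => u n; change ((1 * u, (1 + n)%R) = (u * 1, (n + 1)%R) :> F2xZ).
by rewrite mul1g mulg1 addrC.
Qed.

Lemma F2xZ_ind (Q : F2xZ -> Prop) :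
  Q 1 ->
  (forall s g, s \in [:: gen_x; gen_y; gen_z] -> Q g -> Q (s * g)) ->
  (forall s g, s \in [:: gen_x; gen_y; gen_z] -> Q g -> Q (s^-1 * g)) ->
  forall g, Q g.
Proof.
move=> Q1 QM QV [[w rw] n]; elim: w rw => [|a w IH] rw.
  have -> : (FreeGroup rw, n) = (1, n) :> F2xZ by congr (_, _); apply: val_inj.
  elim/int_succ_ind: n => [//|n Qn|n Qn].
    have -> : (1, (n + 1)%R) = gen_z * (1, n) :> F2xZ.
      by rewrite gen_z_central; congr (_, _); rewrite mulg1.
    by apply: QM => //; rewrite !inE eqxx !orbT.
  have -> : (1, n) = gen_z^-1 * (1, (n + 1)%R) :> F2xZ.
    apply: (mulgI gen_z); rewrite mulVKg gen_z_central.
    by congr (_, _); rewrite mulg1.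
  by apply: QV => //; rewrite !inE eqxx !orbT.
have rw' : reduced w by exact: path_sorted rw.
have -> : (FreeGroup rw, n) =
    ((if a.2 then free_gen a.1 else (free_gen a.1)^-1), 1) * (FreeGroup rw', n)
    :> F2xZ.
  congr (_, _); last by rewrite mul1g.
  apply: val_inj; rewrite -[LHS](reduce_id rw) /= -(reduce_id rw').
  case: a rw => i [] rw /=;
    by rewrite -/(reduce _) (reduce_id (reduce_reduced w)).
have {}IH := IH rw'; case: a {rw} => i e.
have [->|->] : i = ord0 \/ i = ord_max.
  by case: i => [[|[|i]] Hi] //; [left|right]; apply: val_inj.
- case: e => /=; first by apply: (QM gen_x) => //; rewrite !inE eqxx.
  have -> : (((free_gen (ord0 : 'I_2))^-1, 1) : F2xZ) = gen_x^-1.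
    by congr (_, _); rewrite invg1.
  by apply: QV => //; rewrite !inE eqxx.
- case: e => /=; first by apply: (QM gen_y) => //; rewrite !inE eqxx orbT.
  have -> : (((free_gen (ord_max : 'I_2))^-1, 1) : F2xZ) = gen_y^-1.
    by congr (_, _); rewrite invg1.
  by apply: QV => //; rewrite !inE eqxx orbT.
Qed.

(** The recurrence has order two, so the state of the iteration is the pair
    of the terms of index [i] and [i + 1]. *)
Definition tseq (i : int) : F2xZ :=
  (iterz (fun ab : F2xZ * F2xZ => (ab.2, ab.2 * ab.1^-1))
         (fun ab : F2xZ * F2xZ => (ab.2^-1 * ab.1, ab.1)) i (gen_x, gen_y)).1.

Lemma tseq_rec i : tseq (i + 1)%R * tseq (i - 1)%R = tseq i.
Proof.
have stepK : cancel (fun ab : F2xZ * F2xZ => (ab.2^-1 * ab.1, ab.1))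
                    (fun ab : F2xZ * F2xZ => (ab.2, ab.2 * ab.1^-1)).
  by case=> u v /=; rewrite invgM invgK mulVKg.
rewrite -{1 3}[i](subrK 1%R) /tseq !iterz_succ //=.
by rewrite mulgVK.
Qed.

Definition gen_delta : F2xZ := gen_z^-1 * (tseq 0 * tseq (-3)).

Lemma gen_delta_def : tseq 0 * tseq (-3) = gen_z * gen_delta.
Proof. by rewrite /gen_delta mulVKg. Qed.

Definition base : cusp := (0%R, None).

Definition above_base (p : cusp) : Prop := (0 <= p.1)%R /\ p <> base.

Lemma actC_above p : (0 <= p.1)%R -> above_base (actC p).
Proof.
case: p => k [r|] /= k_ge; last by split.
rewrite /actC; case: ifP => _; first by split.
by case: ifP => _; split=> //=; [lia | case; lia | lia].
Qed.

Lemma actD_above p : above_base p -> above_base (actD p).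
Proof. by case: p => k [r|] [k_ge neq]; split. Qed.

Lemma actDV_above p : above_base p -> above_base (actDV p).
Proof. by case: p => k [r|] [k_ge neq]; split. Qed.

(** A property of all elements of the cone which the identity does not have.
    The generators move [base] up, except for [delta], which fixes it: there the
    sign of the central coordinate takes over. *)
Definition moves_up (g : F2xZ) : Prop :=
  (forall p, above_base p -> above_base (act g p)) /\
  (above_base (act g base) \/ act g base = base /\ ((g.2 : int) < 0)%R).

Lemma moves_upM g h : moves_up g -> moves_up h -> moves_up (g * h).
Proof.
move=> [gP gb] [hP hb]; split=> [p pP|]; first by rewrite actM; apply/gP/hP.
rewrite actM; case: hb => [hb|[-> h_lt]]; first by left; apply: gP.
case: gb => [gb|[-> g_lt]]; [by left | right; split=> //].
change ((g.2 : int) + (h.2 : int) < 0)%R; lia.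
Qed.

Lemma moves_up_not1 : ~ moves_up 1.
Proof.
by case=> _ [[_]|[_]]; [rewrite act1; apply | rewrite ltxx].
Qed.

Lemma moves_upW g :
  (forall p, (0 <= p.1)%R -> above_base (act g p)) -> moves_up g.
Proof. by move=> gP; split=> [p [/gP]|] //; left; apply: gP. Qed.

Lemma act_t2 p : act (tseq 2) p = actD (actD (actC p)).
Proof.
rewrite (_ : tseq 2 = gen_y * gen_x^-1) // actM act_y act_xV.
by rewrite actDVK actCDV actCVK.
Qed.

Lemma act_t2V p : act (tseq 2)^-1 p = actC (actD (actCV (actDV p))).
Proof.
rewrite (_ : (tseq 2)^-1 = gen_x * gen_y^-1); last first.
  by rewrite (_ : tseq 2 = gen_y * gen_x^-1) // invgM invgK.
by rewrite actM act_x act_yV actDVK.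
Qed.

(** In the braid group, [delta = d^6]. *)
Lemma act_gen_delta p :
  act gen_delta p = actD (actD (actD (actD (actD (actD p))))).
Proof.
have -> : gen_delta = gen_z^-1 * (tseq 2 * (gen_y^-1 * gen_x)).
  rewrite /gen_delta; congr (_ * _).
  rewrite (_ : tseq (-3) =
    (gen_y^-1 * gen_x)^-1 * (gen_x^-1 * (gen_y^-1 * gen_x))) //.
  rewrite (_ : tseq 2 = gen_y * gen_x^-1) //.
  by rewrite !invgM !invgK !mulgA mulgV mul1g.
rewrite (actM _ (tseq 2 * _)) (actM (tseq 2)) (actM gen_y^-1).
rewrite act_zV act_t2 act_yV act_x.
rewrite actCDV actCVK actCDV actC3.
have D_shift n q : actD (shift n q) = shift n (actD q) by [].
by rewrite !D_shift shiftD subrr shift0.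
Qed.

Lemma cone_moves_up g : cone tseq gen_delta g -> moves_up g.
Proof.
apply; split=> [_ [u uP [v vP <-]]|s]; first exact: moves_upM.
have zE (i j : int) q : (j = i - 3)%R ->
    act (tseq j * dpow gen_delta (-1)%R) q = act (tseq i)^-1 (shift 1 q).
  by move=> Ej; rewrite (t_dpowN1 tseq_rec gen_delta_def Ej) actM act_z.
have CV_shift q : actCV (shift 1 q) = actC (actC q).
  by rewrite /actCV !actC_shift shiftD subrr shift0.
have DV_shift n q : actDV (shift n q) = shift n (actDV q) by [].
rewrite /= !inE => /or4P[/eqP->|/eqP->|/eqP->|].
- split=> [p pP|]; first by rewrite act_gen_delta; do 6!apply: actD_above.
  by right; rewrite act_gen_delta.
- apply: moves_upW => p p_ge; rewrite (@zE 0%R) //.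
  rewrite -[tseq 0]/gen_x act_xV CV_shift.
  by do 2!apply: actDV_above; apply/actC_above/(proj1 (actC_above p_ge)).
- apply: moves_upW => p p_ge; rewrite (@zE 1%R) //.
  rewrite -[tseq 1]/gen_y act_yV DV_shift CV_shift.
  by apply: actDV_above; apply/actC_above/(proj1 (actC_above _)).
move=> /or4P[/eqP->|/eqP->|/eqP->|/eqP->]; apply: moves_upW => p p_ge.
- rewrite (@zE 2%R) // act_t2V DV_shift CV_shift.
  apply/actC_above/(proj1 (actD_above _)).
  by apply/actC_above/(proj1 (actC_above _)).
- by rewrite -[tseq 0]/gen_x act_x; apply: actC_above.
- by rewrite -[tseq 1]/gen_y act_y; apply/actD_above/actC_above.
- by rewrite act_t2; do 2!apply: actD_above; apply: actC_above.
Qed.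

Lemma tfrac_full g : tfrac tseq gen_z gen_delta g.
Proof.
have tM i : tmonoid tseq gen_delta (tseq i) by apply: tmonoid_t.
have zM : tmonoid tseq gen_delta gen_z.
  by have := tmonoid_zX tseq_rec gen_z_central gen_delta_def 1.
elim/F2xZ_ind: g => [|s g|s g]; first exact: tfrac1.
- rewrite !inE => /or3P[]/eqP-> gT;
    apply: (tfrac_tmonoid tseq_rec gen_z_central gen_delta_def) gT => //.
    exact: (tM 0%R).
  exact: (tM 1%R).
- rewrite !inE => /or3P[]/eqP-> gT.
  + exact: (tfrac_tV tseq_rec gen_z_central gen_delta_def 0%R).
  + exact: (tfrac_tV tseq_rec gen_z_central gen_delta_def 1%R).
  + exact: tfrac_zV.
Qed.

Theorem corollary1p3 :
  exists P : set F2xZ, positive_cone P /\ fg_semigroup P.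
Proof.
exists (cone tseq gen_delta); split.
  apply: (cone_positive tseq_rec gen_z_central gen_delta_def tfrac_full).
  by move=> /cone_moves_up/moves_up_not1.
exists [set` cone_gens tseq gen_delta]%classic; split=> //; exact: finite_seq.
Qed.
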